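(* For integers $n\ge 1$, $p\ge 0$, let $\alpha_{n,p}(t)=\sum_j\alpha_{j;n,p}t^j$, where $\alpha_{j;n,p}$ is the number of saturated $n\times p$ tableaux with exactly $j$ marked cells. Then $$\alpha_{n,p}(t)=-n!\sum_{i=0}^n\frac{r_{n-i+1}}{(n-i)!}\sum_{\lambda\vdash i}\frac{(1+P_\lambda(t))^p}{\lambda!}.$$
   Context: An $n\times p$ tableau is a set of marked cells in an $n\times p$ grid; it is saturated if whenever cells $(x,x'),(x,y'),(y,y')$ are marked then $(y,x')$ is marked. $\lambda\vdash i$ ranges over integer partitions $\lambda=[\lambda_1,\dots,\lambda_k]$ of $i$ (for $i=0$ only the empty partition). $P_\lambda(t)=\sum_{j=1}^k t^{\lambda_j}$ (so $P_\emptyset=0$), and $\lambda!=\left(\prod_j\lambda_j!\right)\left(\prod_i\mathrm{mult}_i(\lambda)!\right)$ where $\mathrm{mult}_i(\lambda)$ is the number of parts of $\lambda$ equal to $i$. The $r_k$ are the Rao Uppuluri-Carpenter numbers, defined by $\sum_{k\ge0}r_k\frac{t^k}{k!}=\exp(1-e^t)$, equivalently $r_k=\sum_{j=0}^k(-1)^jS_{k,j}$ with $S_{k,j}$ Stirling numbers of the second kind ($r_0=1,r_1=-1,r_2=0,r_3=1,\dots$). *)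

(* Defs.v *)
From HB Require Import structures.
From mathcomp Require Import all_boot all_order all_algebra.
Set Implicit Arguments. Unset Strict Implicit. Unset Printing Implicit Defensive.
Import Order.TTheory GRing.Theory Num.Theory.

(* An n x p tableau: a set of marked cells (row, column). *)
Definition saturated (n p : nat) (T : {set 'I_n * 'I_p}) : bool :=
  [forall x : 'I_n, forall y : 'I_n, forall x' : 'I_p, forall y' : 'I_p,
     [&& (x, x') \in T, (x, y') \in T & (y, y') \in T] ==> ((y, x') \in T)].

Definition alpha_coef (n p j : nat) : nat :=
  #|[set T : {set 'I_n * 'I_p} | saturated T && (#|T| == j)]|.

Local Open Scope ring_scope.

Definition alpha_poly (n p : nat) : {poly rat} :=
  \sum_(j < (n * p).+1) (alpha_coef n p j)%:R *: 'X^j.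

Fixpoint stirling2 (k j : nat) : nat :=
  match k, j with
  | 0, 0 => 1
  | 0, _.+1 => 0
  | _.+1, 0 => 0
  | k'.+1, j'.+1 => j'.+1 * stirling2 k' j'.+1 + stirling2 k' j'
  end.

Definition rUC (k : nat) : int :=
  \sum_(j < k.+1) (-1) ^+ j * (stirling2 k j)%:Z.

Definition is_partition (i : nat) (s : seq nat) : bool :=
  [&& sorted geq s, all (fun x => 0 < x)%N s & sumn s == i].

(* finite list of all partitions of i (each exactly once): filter the
   candidates of length k <= i with parts in 1..i *)
Definition partitions (i : nat) : seq (seq nat) :=
  [seq s <- flatten [seq [seq [seq (nat_of_ord x).+1 | x <- val t]
                          | t <- enum {: k.-tuple 'I_i}] | k <- iota 0 i.+1]
   | is_partition i s].

Definition Ppoly (s : seq nat) : {poly rat} := \sum_(x <- s) 'X^x.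

Definition lamfact (s : seq nat) : nat :=
  (\prod_(x <- s) x`! * \prod_(m <- undup s) (count_mem m s)`!)%N.

(* Main.v *)
Require Import Defs.
From HB Require Import structures.
From mathcomp Require Import all_boot all_order all_algebra.
From mathcomp Require Import ring zify.
Set Implicit Arguments. Unset Strict Implicit. Unset Printing Implicit Defensive.
Import Order.TTheory GRing.Theory Num.Theory.

(* A tableau is saturated iff its columns, as subsets of the rows, are pairwise
   equal or disjoint, i.e. iff its nonempty columns form a family of disjoint
   blocks (a partial partition of the rows).  For a partial partition F,
   (1 + P_F(t))^p enumerates the tableaux whose nonempty columns all belong to F,
   so Moebius inversion writes alpha as the sum over F of (1 + P_F(t))^p weighted
   by the sum of (-1)^|H - F| over the partial partitions H containing F.  This
   weight is the signed count of partial partitions of the m = n - |cover F|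
   remaining rows; those with j blocks number S(m+1, j+1), whence -r_(m+1).
   Finally, n!/((n-i)! lambda!) partial partitions have block sizes lambda |- i. *)

(** * Partial partitions of a finite set *)

Section PartialPartitions.

Variable T : finType.
Implicit Types (A B : {set T}) (F G H S : {set {set T}}).

Definition ppart A F : bool := [&& trivIset F, set0 \notin F & cover F \subset A].

Definition block_sizes F : seq nat := [seq #|B| | B : {set T} <- enum F].

Lemma setDD_eq A B : (A :\: (A :\: B) == B) = (B \subset A).
Proof. by rewrite setDDr setDv set0U; exact/eqP/setIidPr. Qed.

Lemma cover_subP F A :
  reflect {in F, forall B, B \subset A} (cover F \subset A).
Proof. exact: bigcupsP. Qed.

Lemma coverU F G : cover (F :|: G) = cover F :|: cover G.
Proof. exact: bigcup_setU. Qed.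

Lemma ppartS A F G : G \subset F -> ppart A F -> ppart A G.
Proof.
move=> sGF /and3P[tF F0 /cover_subP sFA]; apply/and3P; split.
- exact: trivIsetS tF.
- by apply: contra F0 => /(subsetP sGF).
- by apply/cover_subP => B /(subsetP sGF)/sFA.
Qed.

(** Extending [F] amounts to choosing a partial partition of the uncovered points. The condition
    [[disjoint F & G]] matters because [trivIset] of a union tolerates a block shared by [F] and
    [G]. *)
Lemma ppartU A F G : ppart A F ->
  ppart A (F :|: G) && [disjoint F & G] = ppart (A :\: cover F) G.
Proof.
move=> /and3P[tF F0 sFA]; apply/andP/and3P.
- case=> /and3P[tU U0 sUA] dFG; split.
  + exact: trivIsetS (subsetUr F G) tU.
  + by apply: contra U0; rewrite inE => ->; rewrite orbT.
  + apply/cover_subP => B BG; rewrite subsetD.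
    rewrite (cover_subP _ _ sUA) ?inE ?BG ?orbT //=.
    apply/bigcup_disjointP => C CF.
    apply: (trivIsetP tU); rewrite ?inE ?BG ?CF ?orbT //.
    apply: contraTneq CF => <-; by rewrite (disjointFl dFG).
- case=> tG G0; rewrite subsetD => /andP[sGA dGF]; split.
    apply/and3P; split.
    + by apply: trivIsetU => //; rewrite disjoint_sym.
    + by rewrite inE negb_or F0.
    + by rewrite coverU subUset sFA.
  rewrite disjoint_subset; apply/subsetP => B BF; rewrite inE.
  apply/negP => BG; case/negP: F0.
  (* A block shared by [F] and [G] lies in both covers, which are disjoint, so it would be empty. *)
  suff <- : B = set0 by [].
  apply/eqP; rewrite -subset0 -(eqP (_ : cover G :&: cover F == set0)).
    by rewrite subsetI !(bigcup_sup B).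
  by rewrite setI_eq0.
Qed.

Lemma ppart0 A : ppart A set0.
Proof.
by rewrite /ppart /trivIset /cover !big_set0 cards0 eqxx in_set0 sub0set.
Qed.

Lemma ppart1 A B : ppart A [set B] = (B != set0) && (B \subset A).
Proof.
by rewrite /ppart /trivIset /cover !big_set1 eqxx inE eq_sym.
Qed.

Lemma card_ppart A F : ppart A F -> (#|F| <= #|A|)%N.
Proof.
case/and3P=> tF F0 sFA; apply: leq_trans (subset_leq_card sFA).
rewrite -(eqP tF) -sum1_card; apply: leq_sum => B BF.
by rewrite card_gt0; apply: contraNneq F0 => <-.
Qed.

(** Double counting of families with a marked block: deleting that block [B] leaves an arbitrary
    partial partition of [A :\: B]. Both enumerations below draw their recurrence from this. *)
Lemma sum_marked_block A (phi : {set T} -> {set {set T}} -> nat) :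
  (\sum_(F | ppart A F) \sum_(B in F) phi B (F :\ B) =
   \sum_(B | (B != set0) && (B \subset A))
     \sum_(F | ppart (A :\: B) F) phi B F)%N.
Proof.
rewrite (exchange_big_dep (fun B => (B != set0) && (B \subset A))) /=; last first.
  move=> F B /and3P[_ F0 /cover_subP sFA] BF; rewrite sFA // andbT.
  by apply: contraNneq F0 => <-.
apply: eq_bigr => B; rewrite -ppart1 => pB.
rewrite (reindex_onto (fun F => B |: F) (fun F => F :\ B)) /=; last first.
  by move=> F /andP[_ BF]; rewrite setD1K.
have covB : cover [set B] = B by rewrite /cover big_set1.
apply: eq_big => F; last by case/andP=> _ /eqP->.
rewrite -[in RHS]covB -(ppartU F pB) setU11 andbT disjoints1; congr (_ && _).
by apply/eqP/idP => [<-|/setU1K//]; rewrite !inE eqxx.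
Qed.

Lemma block_sizesU1 B F : B \notin F ->
  perm_eq (block_sizes (B |: F)) (#|B| :: block_sizes F).
Proof.
move=> BF; apply: (perm_map (fun B : {set T} => #|B|) (t := B :: enum F)).
apply: uniq_perm; rewrite ?enum_uniq //= ?mem_enum ?BF ?enum_uniq //.
by move=> C; rewrite inE !mem_enum !inE.
Qed.

Lemma sumn_block_sizes A F : ppart A F -> sumn (block_sizes F) = #|cover F|.
Proof.
case/and3P=> tF _ _; by rewrite -(eqP tF) /block_sizes sumnE big_map big_enum.
Qed.

Lemma big_block_sizes (R : Type) (idx : R) (op : Monoid.com_law idx) F
    (h : nat -> R) :
  \big[op/idx]_(x <- block_sizes F) h x = \big[op/idx]_(B in F) h #|B|.
Proof. by rewrite big_map big_enum. Qed.

Lemma block_sizes_gt0 A F : ppart A F -> all (fun x => 0 < x)%N (block_sizes F).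
Proof.
case/and3P=> _ F0 _; apply/allP => x /mapP[B]; rewrite mem_enum => BF ->.
by rewrite card_gt0; apply: contraNneq F0 => <-.
Qed.


(** Here [k] is the size of the complement of [B] in [A], hence [k < #|A|] for nonempty [B]. *)
Lemma sum_subsetD (f : nat -> nat) A :
  (\sum_(B | (B != set0) && (B \subset A)) f #|A :\: B| =
   \sum_(k < #|A|) 'C(#|A|, k) * f k)%N.
Proof.
rewrite (reindex_onto (setD A) (setD A)) /=; last first.
  by move=> B /andP[_]; rewrite -setDD_eq => /eqP.
transitivity (\sum_(B : {set T} | (B \subset A) && (#|B| < #|A|)) f #|B|)%N.
  apply: eq_big => [B|B /andP[_ /eqP -> //]].
  rewrite setDD_eq subsetDl andbT -card_gt0 andbC.
  case: (boolP (B \subset A)) => //= sBA.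
  by rewrite cardsD (setIidPr sBA) subn_gt0.
under eq_bigr => k _.
  rewrite -cards_draws -sum_nat_const; under eq_bigl => B do rewrite inE.
  under eq_bigr => B /andP[_ /eqP <-] do over.
  over.
case cA: #|A| => [|m].
  by rewrite big_ord0 big_pred0 // => B; rewrite ltn0 andbF.
rewrite (partition_big (fun B => inord #|B| : 'I_m.+1) predT) //=.
apply: eq_bigr => k _; apply: eq_bigl => B; rewrite -andbA; congr (_ && _).
apply/andP/eqP => [[lt /eqP <-]|->]; first by rewrite inordK.
by rewrite ltn_ord; split=> //; apply/eqP/val_inj; rewrite /= inordK.
Qed.

(** * Counting by number of blocks *)

Lemma stirling2SS m j :
  stirling2 m.+1 j.+1 = (j.+1 * stirling2 m j.+1 + stirling2 m j)%N.
Proof. by []. Qed.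

#[local] Arguments stirling2 : simpl never.

(** The recurrence that marking one of [j] blocks will require, with [k] points outside the marked
    block; it follows from Pascal's rule by induction on [m]. *)
Lemma stirling2_binomial m j :
  (j * stirling2 m.+1 j.+1 = \sum_(k < m) 'C(m, k) * stirling2 k.+1 j)%N.
Proof.
elim: m j => [|m IH] [|j].
- by rewrite big_ord0.
- by rewrite big_ord0 !stirling2SS !muln0.
- by rewrite big1 // => k _; rewrite muln0.
rewrite big_ord_recl bin0 mul1n.
under eq_bigr => k _ do rewrite lift0 binS mulnDl.
rewrite big_split addnA /=.
(* Both sides are the sum over [k <= m]: one splits off the first term, the other the last term and
   applies the induction hypothesis. *)
have -> : (stirling2 1 j.+1 + \sum_(k < m) 'C(m, k.+1) * stirling2 k.+2 j.+1 =
  j.+1 * stirling2 m.+1 j.+2 + stirling2 m.+1 j.+1)%N.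
  have := @big_ord_recr _ 0%N addn m (fun k => 'C(m, k) * stirling2 k.+1 j.+1)%N.
  by rewrite big_ord_recl IH binn bin0 !mul1n.
under eq_bigr => k _ do rewrite stirling2SS mulnDr mulnCA.
rewrite big_split -big_distrr /= -!IH (stirling2SS m.+1).
nia.
Qed.

Definition nppart A j := #|[set F | ppart A F & #|F| == j]|.

(** Bijectively, an extra point forms one more block with the uncovered points. The proof instead
    goes by induction on [j]: marking a block counts each family [j.+1] times and leads to
    [stirling2_binomial]. *)
Lemma nppart_stirling2 A j : nppart A j = stirling2 #|A|.+1 j.+1.
Proof.
elim: j A => [|j IH] A.
  transitivity 1%N.
    rewrite /nppart (_ : [set _ | _] = [set set0]) ?cards1 //.
    apply/setP => F; rewrite !inE cards_eq0; case: eqP => [->|_]; rewrite ?andbF //.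
    by rewrite ppart0.
  by elim: #|A| => // m IHm; rewrite stirling2SS mul1n -IHm.
apply/eqP; rewrite -(eqn_pmul2l (ltn0Sn j)) stirling2_binomial; apply/eqP.
have := sum_marked_block A (fun _ F => (#|F| == j) : nat).
rewrite (eq_bigr (fun F => j.+1 * (#|F| == j.+1))%N); last first.
  move=> F _; transitivity (\sum_(B in F) (#|F| == j.+1))%N.
    by apply: eq_bigr => B BF; rewrite (cardsD1 B F) BF.
  by rewrite sum_nat_const; case: eqP => [->|] //; rewrite !muln0.
rewrite -big_distrr /= -big_mkcondr /= sum1dep_card -/(nppart _ _) => ->.
rewrite -(sum_subsetD (fun k => stirling2 k.+1 j.+1)).
by apply: eq_bigr => B _; rewrite -IH -big_mkcondr /= sum1dep_card.
Qed.

(** * Counting by block sizes *)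

Lemma lamfact_cons a s :
  lamfact (a :: s) = (a`! * (count_mem a s).+1 * lamfact s)%N.
Proof.
rewrite /lamfact big_cons -!mulnA; congr (_ * _)%N; rewrite mulnCA; congr (_ * _)%N.
(* Prepending [a] changes only its own multiplicity c, whose factorial gains the factor c + 1. *)
have other r : a \notin r ->
    (\prod_(m <- r) (count_mem m (a :: s))`! = \prod_(m <- r) (count_mem m s)`!)%N.
  move=> ar; apply: eq_big_seq => m mr /=.
  by rewrite (_ : a == m = false) //; apply: contraNF ar => /eqP->.
have [as_|as_] := boolP (a \in s); last first.
  rewrite /= (negPf as_) big_cons other ?mem_undup //= eqxx.
  by rewrite (count_memPn as_) mul1n.
have au : a \in undup s by rewrite mem_undup.
rewrite [undup (a :: s)]/= as_ !(big_rem a au) /= other.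
  by rewrite eqxx add1n factS mulnA.
by rewrite mem_rem_uniqF ?undup_uniq.
Qed.

(** Induction on [s], marking a block of size [a]: a family with sizes [a :: s] has
    [(count_mem a s).+1] such blocks, and the block can be chosen in ['C(#|A|, a)] ways. The product
    form avoids division. *)
Lemma nppart_sizes s A : all (fun x => 0 < x)%N s -> (sumn s <= #|A|)%N ->
  (#|[set F | ppart A F & perm_eq (block_sizes F) s]|
     * (lamfact s * (#|A| - sumn s)`!) = #|A|`!)%N.
Proof.
elim: s A => [|a s IH] A.
  move=> _ _; rewrite (_ : [set _ | _] = [set set0]).
    by rewrite cards1 /lamfact !big_nil subn0 !mul1n.
  apply/setP => F; rewrite !inE.
  have -> : perm_eq (block_sizes F) [::] = (F == set0).
    by rewrite (sameP perm_nilP eqP) -size_eq0 size_map -cardE cards_eq0.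
  case: eqP => [->|_]; rewrite ?andbF //.
  by rewrite ppart0.
move=> /= /andP[a0 s0] le.
have := sum_marked_block A
  (fun B F => ((#|B| == a) && perm_eq (block_sizes F) s) : nat).
rewrite (eq_bigr (fun F => (count_mem a s).+1 *
    perm_eq (block_sizes F) (a :: s))%N); last first.
  move=> F _.
  transitivity (\sum_(B in F) (#|B| == a) * perm_eq (block_sizes F) (a :: s))%N.
    apply: eq_bigr => B BF; rewrite -mulnb; case: eqP => // Ba.
    have /block_sizesU1 : B \notin F :\ B by rewrite setD11.
    by rewrite setD1K // Ba => /permPl->; rewrite perm_cons.
  rewrite -big_distrl /=; case: (boolP (perm_eq _ _)) => [/permP e|]; rewrite ?muln0 //.
  have -> : (count_mem a s).+1 = count_mem a (a :: s) by rewrite /= eqxx.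
  rewrite !muln1 -e -sum1_count [RHS]big_mkcond big_block_sizes.
  by apply: eq_bigr => B _ /=; case: eqP.
rewrite -big_distrr /= -big_mkcondr /= sum1dep_card => cnt.
rewrite lamfact_cons; set N := #|_| in cnt *.
rewrite (_ : N * _ = a`! * (((count_mem a s).+1 * N) *
  (lamfact s * (#|A| - a - sumn s)`!)))%N; last by rewrite subnDA; nia.
rewrite cnt big_distrl /=.
have leaA : (a <= #|A|)%N by lia.
transitivity (a`! * \sum_(B : {set T} | (B \subset A) && (#|B| == a)) (#|A| - a)`!)%N.
  congr (_ * _)%N; rewrite [LHS]big_mkcond [RHS]big_mkcond.
  apply: eq_bigr => B _.
  case: (boolP (B \subset A)) => sBA; rewrite ?andbF //= andbT.
  case: (#|B| =P a) => Ba; last by rewrite big1 ?if_same // => F _.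
  rewrite -card_gt0 Ba a0 /= -big_mkcondr sum1dep_card.
  have cAB : #|A :\: B| = (#|A| - a)%N by rewrite cardsD (setIidPr sBA) Ba.
  by rewrite -cAB IH // cAB; lia.
rewrite sum_nat_cond_const cards_draws.
by rewrite -(bin_fact leaA); nia.
Qed.

End PartialPartitions.

(** * Moebius inversion over partial partitions *)

Local Open Scope ring_scope.

(** Expand the product over [X] of the factors -1 + 1 on [U] and 0 + 1 elsewhere: it vanishes as
    soon as [U] has an element, and sets not inside [U] contribute 0. *)
Lemma sum_sign_subset (R : comNzRingType) (X : finType) (U : {set X}) :
  \sum_(G : {set X} | G \subset U) (-1) ^+ #|G| = (U == set0)%:R :> R.
Proof.
have := bigA_distr 1 +%R (fun i => if i \in U then -1 else 0 : R) (fun=> 1).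
rewrite [X in _ = X](eq_bigr (fun G : {set X} =>
   if G \subset U then (-1) ^+ #|G| else 0 : R)) => [|G _].
  rewrite -big_mkcond /= => <-; case: (set_0Vmem U) => [->|[x xU]].
    by rewrite eqxx big1 // => i _; rewrite inE add0r.
  rewrite (bigD1 x) //= xU addNr mul0r.
  by case: eqP => // U0; rewrite U0 inE in xU.
rewrite -big_mkcond /=; case: ifP => [/subsetP sGU|/negbT/subsetPn[x xG xU]].
  by rewrite -prodr_const; apply: eq_bigr => i /sGU ->.
by rewrite (bigD1 x) //= (negPf xU) mul0r.
Qed.

Section Moebius.

Variable T : finType.
Implicit Types (A B : {set T}) (F G H S : {set {set T}}).

(** Grouping by the number of blocks gives Stirling numbers with second index [j.+1]. The term of
    index 0 in [rUC] is zero, and the index shift produces the sign. *)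
Lemma sum_sign_ppart A :
  \sum_(G | ppart A G) (-1) ^+ #|G| = - (rUC #|A|.+1)%:~R :> rat.
Proof.
rewrite /rUC rmorph_sum big_ord_recl mulr0 rmorph0 add0r -sumrN.
rewrite (partition_big (fun G => inord #|G| : 'I_#|A|.+1) predT) //=.
apply: eq_bigr => j _.
transitivity (\sum_(G in [set G | ppart A G & #|G| == j]) (-1) ^+ j : rat).
  apply: eq_big => [G|G /andP[pG /eqP <-]]; last first.
    by rewrite inordK // ltnS card_ppart.
  rewrite inE; case: (boolP (ppart A G)) => //= /card_ppart le.
  apply/eqP/eqP => [<-|->]; first by rewrite inordK.
  by apply/val_inj; rewrite /= inordK.
rewrite sumr_const -/(nppart _ _) nppart_stirling2.
by rewrite rmorphM rmorphXn /= exprS -mulr_natr; ring.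
Qed.

Lemma sum_ppart_above A F : ppart A F ->
  \sum_(H | ppart A H && (F \subset H)) (-1) ^+ #|H :\: F|
  = - (rUC (#|A| - #|cover F|).+1)%:~R :> rat.
Proof.
move=> pF; have /and3P[_ _ sFA] := pF.
have -> : (#|A| - #|cover F|)%N = #|A :\: cover F| by rewrite cardsD (setIidPr sFA).
rewrite -sum_sign_ppart.
rewrite (reindex_onto (fun G => F :|: G) (fun H => H :\: F)) /=; last first.
  by move=> H /andP[_ sFH]; rewrite -{1}(setIidPr sFH) setID.
have e G : ((F :|: G) :\: F == G) = [disjoint F & G].
  by rewrite setDUl setDv set0U disjoint_sym; apply/eqP/setDidPl.
apply: eq_big => [G|G /andP[_ /eqP->] //].
by rewrite e subsetUl andbT ppartU.
Qed.

(** In use, [S] is the set of nonempty columns of a tableau. Once each weight is opened as an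
    alternating sum over [H] containing [F], the inner sum over [F] between [S] and [H] vanishes
    unless [H = S]. *)
Lemma sum_ppart_rUC A S :
  \sum_(F | ppart A F && (S \subset F)) - (rUC (#|A| - #|cover F|).+1)%:~R
  = (ppart A S)%:R :> rat.
Proof.
under eq_bigr => F /andP[pF _] do rewrite -sum_ppart_above //.
rewrite (exchange_big_dep (ppart A)) /=; last by move=> F H _ /andP[].
rewrite (eq_bigr (fun H => (H == S)%:R)).
  under eq_bigr => H _ do rewrite mulrb.
  rewrite -big_mkcondr /=; case: (boolP (ppart A S)) => pS.
    by rewrite (big_pred1 S) // => H; rewrite andbC /=; case: eqP => [->|].
  by rewrite big_pred0 // => H; rewrite andbC; case: eqP => [->|] //; exact: negPf.
move=> H pH.
rewrite (eq_bigl (fun F => (S \subset F) && (F \subset H))); last first.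
  move=> F; rewrite pH; case: (boolP (F \subset H)) => sFH; rewrite ?andbF //.
  by rewrite (ppartS sFH pH) !andbT.
case: (boolP (S \subset H)) => sSH; last first.
  rewrite big_pred0 => [|F]; first by case: eqP sSH => // ->; rewrite subxx.
  by apply: contraNF sSH => /andP[]; exact: subset_trans.
have -> : (H == S) = (H :\: S == set0) by rewrite setD_eq0 eqEsubset sSH andbT.
rewrite -sum_sign_subset.
(* Complementation in [H] turns the interval from [S] to [H] into the subsets of [H :\: S]. *)
rewrite (reindex_onto (fun F => H :\: F) (fun F => H :\: F)) /=; last first.
  by move=> F /andP[_]; rewrite -setDD_eq => /eqP.
apply: eq_big => [F|F /andP[_ /eqP -> //]].
rewrite setDD_eq subsetDl andbT !subsetD sSH /= andbC; congr (_ && _).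
by rewrite disjoint_sym.
Qed.

End Moebius.

(** * The list of integer partitions *)

Lemma size_sumn_gt0 (s : seq nat) : all (fun x => 0 < x)%N s -> (size s <= sumn s)%N.
Proof. by elim: s => //= x s IH /andP[x0 /IH]; lia. Qed.

Lemma mem_leq_sumn (s : seq nat) x : x \in s -> (x <= sumn s)%N.
Proof. by elim: s => //= y s IH; rewrite inE => /orP[/eqP->|/IH]; lia. Qed.

(** Since parts are positive, a partition of [i] has at most [i] parts, each between 1 and [i], so
    it is among the candidates. *)
Lemma mem_partitions i s : (s \in partitions i) = is_partition i s.
Proof.
rewrite mem_filter; case: (boolP (is_partition i s)) => // /and3P[_ s0 /eqP si].
rewrite andTb.
have [u us] : exists u : seq 'I_i, [seq (nat_of_ord x).+1 | x <- u] = s.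
  have : all (fun x => 0 < x <= i)%N s.
    by apply/allP => x xs; rewrite (allP s0) // -si mem_leq_sumn.
  elim: (s) => [|x r IH] /=; first by exists [::].
  case/andP=> /andP[x0 xi] /IH[u <-].
  have lt : (x.-1 < i)%N by rewrite prednK.
  by exists (Ordinal lt :: u); rewrite /= prednK.
apply/flatten_mapP; exists (size s).
  by rewrite mem_iota ltnS -si size_sumn_gt0.
have su : size u == size s by rewrite -us size_map.
by apply/mapP; exists (Tuple su); rewrite ?mem_enum.
Qed.

Lemma partitions_uniq i : uniq (partitions i).
Proof.
apply: filter_uniq; apply: allpairs_uniq_dep => [|k _|]; rewrite ?iota_uniq ?enum_uniq //.
move=> [k t] [k' t'] _ _ /= e.
(* The sequence determines the tuple length, so candidates of different lengths never collide. *)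
have ek : k = k'.
  by move/(congr1 size): (e); rewrite !size_map !size_tuple.
case: _ / ek t' e => t' e; congr existT; apply: val_inj.
by apply: inj_map e => x y [] /val_inj.
Qed.

(** * Tableaux as functions from columns to sets of rows *)

Section Tableaux.

Variables n p : nat.

Implicit Type c : {ffun 'I_p -> {set 'I_n}}.

Definition tab_of c : {set 'I_n * 'I_p} := [set xy | xy.1 \in c xy.2].

Definition cols (T : {set 'I_n * 'I_p}) : {ffun 'I_p -> {set 'I_n}} :=
  [ffun y => [set x | (x, y) \in T]].

Definition col_blocks c : {set {set 'I_n}} := (c @: 'I_p) :\ set0.

Lemma tab_ofK : cancel tab_of cols.
Proof. by move=> c; apply/ffunP => y; rewrite ffunE; apply/setP => x; rewrite !inE. Qed.

Lemma colsK : cancel cols tab_of.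
Proof. by move=> T; apply/setP => -[x y]; rewrite !inE ffunE inE. Qed.

Lemma card_tab_of c : #|tab_of c| = (\sum_y #|c y|)%N.
Proof.
rewrite -sum1_card (partition_big (fun xy => xy.2) predT) //=.
apply: eq_bigr => y _; rewrite -sum1_card.
rewrite (reindex_onto (fun x => (x, y)) (fun xy => xy.1)) /=.
  by apply: eq_bigl => x; rewrite inE !eqxx !andbT.
by move=> [x z] /andP[_ /eqP /= ->].
Qed.

(** If two columns share a row, saturation puts every row of either into the other, so they
    coincide. *)
Lemma saturated_tab_of c : saturated (tab_of c) = ppart setT (col_blocks c).
Proof.
rewrite /ppart subsetT setD11 !andbT.
apply/forallP/trivIsetP => [sat|tr x].
  move=> B C /setD1P[_ /imsetP[x' _ ->]] /setD1P[_ /imsetP[y' _ ->]].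
  apply: contraR => /pred0Pn[x /andP[/= xx' xy']].
  apply/eqP/setP => y; apply/idP/idP => yc.
    have /forallP/(_ y)/forallP/(_ y')/forallP/(_ x')/implyP := sat x.
    by rewrite !inE /=; apply; apply/and3P.
  have /forallP/(_ y)/forallP/(_ x')/forallP/(_ y')/implyP := sat x.
  by rewrite !inE /=; apply; apply/and3P.
apply/forallP => y; apply/forallP => x'; apply/forallP => y'; apply/implyP.
rewrite !inE /= => /and3P[xx' xy' yy'].
have mem z z' : z \in c z' -> c z' \in col_blocks c.
  move=> zz'; rewrite in_setD1 imset_f // andbT; apply: contraTneq zz' => ->.
  by rewrite inE.
have [->//|/eqP ne] := c x' =P c y'.
by have := disjointFr (tr _ _ (mem _ _ xx') (mem _ _ xy') ne) xx'; rewrite xy'.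
Qed.

Lemma alpha_poly_tableaux :
  alpha_poly n p = \sum_(T : {set 'I_n * 'I_p} | saturated T) 'X^#|T|.
Proof.
have le (T : {set 'I_n * 'I_p}) : (#|T| < (n * p).+1)%N.
  by rewrite ltnS (leq_trans (max_card _)) // card_prod !card_ord.
rewrite (partition_big (fun T => Ordinal (le T)) predT) //=.
apply: eq_bigr => j _.
transitivity (\sum_(T in [set T : {set 'I_n * 'I_p} | saturated T && (#|T| == j)])
   'X^j : {poly rat}); first by rewrite sumr_const scaler_nat.
by apply: eq_big => [T|T]; rewrite inE // => /andP[_ /eqP ->].
Qed.

Lemma alpha_poly_cols :
  alpha_poly n p = \sum_(c | ppart setT (col_blocks c)) \prod_y 'X^#|c y|.
Proof.
rewrite alpha_poly_tableaux (reindex tab_of); last first.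
  by exists cols => ? _; rewrite ?tab_ofK ?colsK.
apply: eq_big => c; first exact: saturated_tab_of.
by move=> _; rewrite card_tab_of expr_sum.
Qed.

(** Each column is chosen independently from [set0 |: F]. The summand 1 is the empty column, counted
    once because [set0] is not in [F]. *)
Lemma sum_col_blocks_sub A (F : {set {set 'I_n}}) : ppart A F ->
  \sum_(c | col_blocks c \subset F) \prod_y 'X^#|c y|
  = (1 + Ppoly (block_sizes F)) ^+ p :> {poly rat}.
Proof.
case/and3P=> _ F0 _.
rewrite /Ppoly big_block_sizes.
have <- : \sum_(B in set0 |: F) 'X^#|B| = 1 + \sum_(B in F) 'X^#|B| :> {poly rat}.
  by rewrite big_setU1 //= cards0.
rewrite -[p in RHS]card_ord -prodr_const bigA_distr_big.
apply: eq_bigl => c; rewrite subDset.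
apply/subsetP/ffun_onP => [sub y|on _ /imsetP[y _ ->]]; last exact: on.
by apply: sub; rewrite imset_f.
Qed.

End Tableaux.

(** The only contribution is the nonincreasing rearrangement of [s0], at [i = sumn s0]. This serves
    to insert a sum over shapes. *)
Lemma sum_partitions_perm (V : nmodType) (v : V) n (s0 : seq nat) :
    all (fun x => 0 < x)%N s0 -> (sumn s0 <= n)%N ->
  \sum_(i < n.+1) \sum_(s <- partitions i | perm_eq s0 s) v = v.
Proof.
move=> pos le; rewrite (bigD1 (inord (sumn s0))) //= inordK //.
rewrite [X in _ + X]big1 ?addr0 => [|i ne]; last first.
  rewrite big_seq_cond big_pred0 // => s; rewrite mem_partitions.
  apply: contraNF ne => /andP[/and3P[_ _ /eqP si] /perm_sumn e].
  by apply/eqP/val_inj; rewrite /= inordK // e.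
have geq_total : total geq by move=> x y; apply: leq_total.
pose s1 := sort geq s0.
have p1 : perm_eq s0 s1 by rewrite perm_sym perm_sort.
have in1 : s1 \in partitions (sumn s0).
  rewrite mem_partitions /is_partition sort_sorted // all_sort pos.
  by rewrite -(perm_sumn p1) eqxx.
rewrite big_mkcond (bigD1_seq s1) ?partitions_uniq //= p1.
rewrite big_seq_cond big1 ?addr0 // => s.
rewrite mem_partitions => /andP[/and3P[ss _ _] ne].
case: ifP => // ps; case/eqP: ne.
apply: (@sorted_eq _ geq) => //.
- by move=> x y z /= xy yz; apply: leq_trans yz xy.
- by move=> x y /= e; apply/eqP; rewrite eqn_leq andbC.
- exact: sort_sorted.
- by rewrite -(permPl ps).
Qed.

Theorem theorem2 (n p : nat) (hn : (1 <= n)%N) :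
  alpha_poly n p =
  - ((n`!)%:R : rat) *:
    \sum_(i < n.+1)
      (((rUC (n - i).+1)%:~R / ((n - i)`!)%:R : rat) *:
        \sum_(s <- partitions i) ((lamfact s)%:R^-1 : rat) *: (1 + Ppoly s) ^+ p).
Proof.
pose w i : rat := - (rUC (n - i).+1)%:~R.
pose pp := ppart [set: 'I_n].
have leF F : pp F -> (sumn (block_sizes F) <= n)%N.
  by move=> pF; rewrite (sumn_block_sizes pF) -[X in (_ <= X)%N]card_ord max_card.
transitivity (\sum_(F | pp F)
    w (sumn (block_sizes F)) *: (1 + Ppoly (block_sizes F)) ^+ p).
  rewrite alpha_poly_cols.
  (* Each power opens into column functions. After the exchange, the weights attached to [c] come
     from the [F] containing [col_blocks c] and add up to the indicator of saturation. *)
  under [RHS]eq_bigr => F pF do rewrite -(sum_col_blocks_sub p pF) scaler_sumr.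
  rewrite (exchange_big_dep predT) //= big_mkcond /=; apply: eq_bigr => c _.
  rewrite -scaler_suml.
  rewrite (eq_bigr (fun F => - (rUC (#|[set: 'I_n]| - #|cover F|).+1)%:~R)).
    by rewrite sum_ppart_rUC; case: ifP; rewrite ?scale1r ?scale0r.
  by move=> F /andP[pF _]; rewrite /w (sumn_block_sizes pF) cardsT card_ord.
(* Each family is filed under its shape, so that the sum over families can become innermost. *)
under eq_bigr => F pF do rewrite
  -[_ *: _](sum_partitions_perm _ (block_sizes_gt0 pF) (leF F pF)).
rewrite exchange_big /= scaler_sumr; apply: eq_bigr => i _.
rewrite (exchange_big_dep predT) //= scalerA scaler_sumr big_seq [RHS]big_seq.
apply: eq_bigr => s; rewrite mem_partitions => /and3P[_ s0 /eqP si].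
rewrite (eq_bigr (fun=> w i *: (1 + Ppoly s) ^+ p)); last first.
  move=> F /andP[pF ps]; rewrite (perm_sumn ps) si.
  by rewrite /Ppoly (perm_big _ ps).
rewrite sumr_const -scaler_nat !scalerA; congr (_ *: _).
have sn : (sumn s <= #|[set: 'I_n]|)%N by rewrite cardsT card_ord si -ltnS.
(* The number of families of shape [s] turns the weight into the required coefficient. *)
have := congr1 (fun m => m%:R : rat) (nppart_sizes s0 sn).
rewrite cardsT card_ord si natrM (natrM _ (lamfact s)) cardsE => <-.
have l0 : (lamfact s)%:R != 0 :> rat.
  rewrite pnatr_eq0 -lt0n muln_gt0 !prodn_gt0 // => *; exact: fact_gt0.
have f0 : (n - i)`!%:R != 0 :> rat by rewrite pnatr_eq0 -lt0n fact_gt0.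
by rewrite /w; field; rewrite l0 f0.
Qed.
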